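(* Let $n\in\mathbb N$ and let $C$ be an $n\times n$ conference matrix which is either symmetric ($C^\top=C$) or skew-symmetric ($C^\top=-C$). Let $(a_i)_{i=0}^{5}\in\{1,-1\}^6$ and define $H:[n]^3\to\{\pm1\}$ by \[ H(x,y,z)=\begin{cases} a_0 & \text{if } x=y=z,\\ a_1 & \text{if } y=z\neq x,\\ a_2 & \text{if } x=z\neq y,\\ a_3 & \text{if } x=y\neq z,\\ a_4 & \text{if } C(x,y)C(y,z)C(z,x)=-1,\\ a_5 & \text{if } C(x,y)C(y,z)C(z,x)=1. \end{cases} \] Then $H$ is an $(n,3,2)$-Hadamard cube if and only if $a_0a_1a_2a_3=a_4a_5=-1$.
   Context: $[n]=\{1,\dots,n\}$. A conference matrix of order $n$ is an $n\times n$ matrix $C$ with zero diagonal, off-diagonal entries in $\{\pm1\}$, and $CC^\top=(n-1)I_n$. For a $d$-dimensional array $H$ indexed by $[n]^d$, an $\ell$-layer is the sub-array of $n^\ell$ cells obtained by fixing $d-\ell$ of the coordinates to given values (the other $\ell$ vary); two distinct layers are parallel if they are obtained by fixing the same set of coordinates, and orthogonal if the sum of products of corresponding entries is $0$. An $(n,d,\ell)$-Hadamard hypercube ($\ell\in[d-1]$) is a $d$-dimensional $\pm1$-array indexed by $[n]^d$ in which every two parallel $\ell$-layers are orthogonal; for $d=3$ it is called a Hadamard cube.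
   Formalization: The ''only if'' direction is stated only for n > 6 (the ''if'' direction for all n), since it fails at every smaller order of a conference matrix, e.g. n = 4 with a = (1,1,−1,−1,1,1). *)

(* Defs.v *)
From mathcomp Require Import all_boot all_order all_algebra.

Set Implicit Arguments.
Unset Strict Implicit.
Unset Printing Implicit Defensive.

Import Order.TTheory GRing.Theory Num.Theory.
Local Open Scope ring_scope.

Definition is_sign (x : int) : Prop := x = 1 \/ x = -1.

Definition conference_matrix (n : nat) (C : 'M[int]_n) : Prop :=
  [/\ forall i, C i i = 0,
      forall i j, i != j -> is_sign (C i j)
    & C *m C^T = (n%:R - 1)%:M].

(* [n]^d, with coordinates and coordinate values counted from 0 *)
Definition cell (n d : nat) : finType := {ffun 'I_d -> 'I_n}.

(* The layer that fixes each coordinate i in S to the value u i, as a set of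
   cells; the values of u outside S play no role. It is a (d - #|S|)-layer. *)
Definition layer (n d : nat) (S : {set 'I_d}) (u : cell n d) :
    {set cell n d} :=
  [set p : cell n d | [forall i in S, p i == u i]].

(* The cell of [layer S v] in the same position as p, that is, with the same
   coordinates outside S. *)
Definition move_to_layer (n d : nat) (S : {set 'I_d}) (v p : cell n d) :
    cell n d :=
  [ffun i => if i \in S then v i else p i].

Definition orthogonal_layers (n d : nat) (H : cell n d -> int)
    (S : {set 'I_d}) (u v : cell n d) : Prop :=
  \sum_(p in layer S u) H p * H (move_to_layer S v p) = 0.

Definition hadamard_hypercube (n d l : nat) (H : cell n d -> int) : Prop :=
  [/\ (0 < l < d)%N,
      forall p, is_sign (H p)
    & forall S : {set 'I_d}, #|S| = (d - l)%N ->
        forall u v : cell n d, layer S u != layer S v ->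
          orthogonal_layers H S u v].

(* The numerals in a 0, ..., a 5 and in p 0, p 1, p 2 are elements of 'I_6 and
   'I_3. When C is a conference matrix, the last branch is reached exactly when
   x, y, z are distinct and the product of the three entries of C is 1. *)
Definition conference_cube (n : nat) (C : 'M[int]_n) (a : 'I_6 -> int)
    (p : cell n 3) : int :=
  let x := p 0 in let y := p 1 in let z := p 2 in
  if (x == y) && (y == z) then a 0
  else if (y == z) && (z != x) then a 1
  else if (x == z) && (z != y) then a 2
  else if (x == y) && (y != z) then a 3
  else if C x y * C y z * C z x == -1 then a 4
  else a 5.

(* Main.v *)
(** Two parallel layers at coordinate values u != v meet in one sum over y, z.
    On triples of distinct indices put t = H, and t = 0 elsewhere. Then
    t(u,y,z) t(v,y,z) = w(y) w(z) [y != z] with w^2 the indicator of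
    ~{u,v}, so these terms add up to (sum w)^2 - (n-2), while the diagonal
    y = z gives n-2 + 2 a_0 a_1 and the cells (u,v), (v,u) give 2 a_2 a_3.
    If a_4 = -a_5, then w(y) = C(u,y) C(v,y), and orthogonality of rows of C
    kills (sum w)^2 and all mixed terms: the inner product is
    2 (a_0 a_1 + a_2 a_3). If a_4 = a_5 = s, then w is the indicator itself,
    and the product is 2 (a_0 a_1 + a_2 a_3) + (n-2) (n-2 + 2 s (a_2 + a_3)),
    which is positive for n > 6. The other two layer directions follow by
    cyclic symmetry. *)

Require Import Defs.
From mathcomp Require Import all_boot all_order all_algebra.
From mathcomp Require Import ring zify.

Set Implicit Arguments.
Unset Strict Implicit.
Unset Printing Implicit Defensive.

Import Order.TTheory GRing.Theory Num.Theory.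
Local Open Scope ring_scope.

Lemma is_signM (x y : int) : is_sign x -> is_sign y -> is_sign (x * y).
Proof. by case=> ->; case=> ->; [left|right|right|left]. Qed.

Lemma is_sign_sqr (x : int) : is_sign x -> x * x = 1.
Proof. by case=> ->. Qed.

Lemma sum_pred1 (I : finType) (k : I) (F : I -> int) :
  \sum_i (i == k)%:R * F i = F k.
Proof.
rewrite (bigD1 k) //= eqxx mul1r big1 ?addr0 // => i /negbTE ->.
by rewrite mul0r.
Qed.

(** * Inner product of two parallel layers, for general entries on distinct triples *)

Section LayerProduct.

Variables (n : nat) (a0 a1 a2 a3 : int) (t : 'I_n -> 'I_n -> 'I_n -> int).

(** The entries on distinct triples stay abstract, so that one computation serves both [a 4 = - a 5]
    and [a 4 = a 5], in every layer direction. *)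
Definition fill_cube (x y z : 'I_n) : int :=
  if (x == y) && (y == z) then a0
  else if y == z then a1
  else if x == z then a2
  else if x == y then a3
  else t x y z.

Hypotheses (a1_sign : is_sign a1).
Hypotheses (txxz : forall x z, t x x z = 0) (txyx : forall x y, t x y x = 0)
           (txyy : forall x y, t x y y = 0).

Variables (u v : 'I_n) (w : 'I_n -> int).
Hypothesis neq_uv : u != v.
Hypothesis t_mul : forall y z,
  t u y z * t v y z = w y * w z * (1 - (y == z)%:R).
Hypothesis w_sqr : forall y, w y * w y = 1 - (y == u)%:R - (y == v)%:R.

(** One term per region of the (y, z) square: generic cells, the diagonal, the cells (u, v) and (v,
    u), and the four lines where one factor is [a2] or [a3] and the other an entry of [t]. Where
    regions overlap, the vanishing of [t] removes the surplus. *)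
Lemma fill_cube_mul (y z : 'I_n) :
  fill_cube u y z * fill_cube v y z =
    t u y z * t v y z
  + (z == y)%:R * (1 + (y == u)%:R * (a0 * a1 - 1)
                     + (y == v)%:R * (a0 * a1 - 1))
  + (y == u)%:R * ((z == v)%:R * (a2 * a3))
  + (y == v)%:R * ((z == u)%:R * (a2 * a3))
  + (y == u)%:R * (a3 * t v u z) + (z == u)%:R * (a2 * t v y u)
  + (y == v)%:R * (a3 * t u v z) + (z == v)%:R * (a2 * t u y v).
Proof.
have a11 := is_sign_sqr a1_sign.
have vu : (v == u) = false by rewrite eq_sym; apply/negbTE.
have uv := negbTE neq_uv.
rewrite /fill_cube ![u == _]eq_sym ![v == _]eq_sym ![z == y]eq_sym.
have [->|yu] := eqVneq y u; first rewrite ![u == _]eq_sym.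
  by have [->|zu] := eqVneq z u; [|have [->|zv] := eqVneq z v];
     rewrite ?eqxx ?uv ?vu ?(negbTE zu) ?txxz ?txyx ?txyy /=; ring.
have [->|yv] := eqVneq y v; first rewrite ![v == _]eq_sym.
  by have [->|zu] := eqVneq z u; [|have [->|zv] := eqVneq z v];
     rewrite ?eqxx ?uv ?vu ?(negbTE zu) ?txxz ?txyx ?txyy /=; ring.
have [<-|yz] := eqVneq y z.
  by rewrite a11 txyy (negbTE yu) (negbTE yv) /=; ring.
by have [->|zu] := eqVneq z u; [|have [->|zv] := eqVneq z v];
     rewrite ?eqxx ?uv ?vu ?txxz ?txyx ?txyy /=; ring.
Qed.

Lemma sum_fill_cube_mul :
  \sum_y \sum_z fill_cube u y z * fill_cube v y z =
    (\sum_y w y) ^+ 2 + 2 * (a0 * a1 + a2 * a3)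
  + a3 * (\sum_z t v u z + \sum_z t u v z)
  + a2 * (\sum_y t v y u + \sum_y t u y v).
Proof.
have inner y : \sum_z fill_cube u y z * fill_cube v y z =
    w y * (\sum_z w z) + (y == u)%:R * (a0 * a1 + a2 * a3)
  + (y == v)%:R * (a0 * a1 + a2 * a3)
  + (y == u)%:R * (a3 * \sum_z t v u z) + (y == v)%:R * (a3 * \sum_z t u v z)
  + a2 * t v y u + a2 * t u y v.
  under eq_bigr => z _ do rewrite fill_cube_mul t_mul.
  rewrite !big_split /= -!mulr_sumr !sum_pred1.
  (* Excluding z = y costs [w y * w y]; by [w_sqr] this cancels the contribution [a1 * a1 = 1] of
     the diagonal cell, leaving [a0 * a1] at y = u and y = v only. *)
  have -> : \sum_z w y * w z * (1 - (y == z)%:R) =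
      w y * (\sum_z w z) - w y * w y.
    rewrite -(sum_pred1 y (fun z => w y * w z)) mulr_sumr -sumrB.
    by apply: eq_bigr => z _; rewrite eq_sym; ring.
  by rewrite w_sqr; ring.
under eq_bigr => y _ do rewrite inner.
by rewrite !big_split /= -!mulr_sumr !sum_pred1 -mulr_suml; ring.
Qed.

End LayerProduct.

Lemma fill_cube_sign n (a0 a1 a2 a3 : int) (t : 'I_n -> 'I_n -> 'I_n -> int)
    x y z :
  is_sign a0 -> is_sign a1 -> is_sign a2 -> is_sign a3 ->
  (x != y -> y != z -> z != x -> is_sign (t x y z)) ->
  is_sign (fill_cube a0 a1 a2 a3 t x y z).
Proof.
move=> s0 s1 s2 s3 st; rewrite /fill_cube.
have [-> //|xy] := eqVneq x y; first by case: (y == z).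
have [_ //|yz] := eqVneq y z.
have [_ //|xz] := eqVneq x z.
by rewrite /=; apply: st => //; rewrite eq_sym.
Qed.

(** * Entries proportional to the triple product of [C] *)

Section ConferenceCube.

Variables (n : nat) (C : 'M[int]_n).
Hypotheses (hC : conference_matrix C) (hsym : C^T = C \/ C^T = - C).

Let C0 i : C i i = 0. Proof. by case: hC. Qed.

Lemma conference_sqr i j : C i j * C i j = 1 - (i == j)%:R.
Proof.
have [<-|ij] := eqVneq i j; first by rewrite C0 subrr mulr0.
by case: hC => _ + _ => /(_ i j ij) /is_sign_sqr ->; rewrite subr0.
Qed.

Lemma conference_row_orthogonal u v : u != v -> \sum_y C u y * C v y = 0.
Proof.
case: hC => _ _ /matrixP /(_ u v) + /negbTE uv; rewrite !mxE uv mulr0n => h.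
rewrite -[RHS]h.
by apply: eq_bigr => y _; rewrite mxE.
Qed.

(** The sign [e] treats the symmetric and skew-symmetric cases at once. *)
Lemma conference_swap :
  exists2 e : int, is_sign e & forall i j, C j i = e * C i j.
Proof.
case: hsym => /matrixP h.
  by exists 1 => [|i j]; [left | have := h i j; rewrite mxE mul1r].
by exists (-1) => [|i j]; [right | have := h i j; rewrite !mxE mulN1r].
Qed.

Definition triangle (x y z : 'I_n) : int := C x y * C y z * C z x.

Lemma triangle_rot x y z : triangle y z x = triangle x y z.
Proof. by rewrite /triangle; ring. Qed.

Lemma triangle_sign x y z :
  x != y -> y != z -> z != x -> is_sign (triangle x y z).
Proof. by case: hC => _ s _ xy yz zx; do 2?apply: is_signM; apply: s. Qed.

Variables (a0 a1 a2 a3 : int).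
Hypothesis a1_sign : is_sign a1.

Lemma sum_triangle_cube_mul (s : int) (u v : 'I_n) :
    is_sign s -> u != v ->
  let H := fill_cube a0 a1 a2 a3 (fun x y z => s * triangle x y z) in
  \sum_y \sum_z H u y z * H v y z = 2 * (a0 * a1 + a2 * a3).
Proof.
move=> ss uv H; have [e se Ce] := conference_swap.
have ee := is_sign_sqr se; have sss := is_sign_sqr ss.
have ct i j (c : int) : i != j -> \sum_y c * (C i y * C j y) = 0.
  by move=> ij; rewrite -mulr_sumr conference_row_orthogonal ?mulr0.
have vu : v != u by rewrite eq_sym.
rewrite (@sum_fill_cube_mul _ a0 a1 a2 a3 _ _ _ _ _ u v
  (fun y => C u y * C v y)) //.
(* One transposition puts the summation index second in both factors containing it, which leaves a
   multiple of the inner product of rows i and j. *)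
- have mid (i j : 'I_n) : i != j -> \sum_z s * triangle i j z = 0.
    move=> ij; rewrite -[RHS](ct _ _ (s * e * C i j) ij); apply: eq_bigr => z _.
    by rewrite /triangle (Ce i z); ring.
  have last (i j : 'I_n) : i != j -> \sum_y s * triangle i y j = 0.
    move=> ij; rewrite -[RHS](ct _ _ (s * e * C j i) ij); apply: eq_bigr => z _.
    by rewrite /triangle (Ce j z); ring.
  by rewrite conference_row_orthogonal // !mid // !last //; ring.
- by move=> x z; rewrite /triangle C0; ring.
- by move=> x y; rewrite /triangle C0; ring.
- by move=> x y; rewrite /triangle C0; ring.
(* The two transpositions contribute [e * e = 1], and the common factor [C y z] is squared into the
   indicator of y != z. *)
- move=> y z; rewrite /triangle (Ce u z) (Ce v z) -conference_sqr.
  transitivity (s * s * (e * e) *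
    (C u y * C v y * (C u z * C v z) * (C y z * C y z))); first by ring.
  by rewrite sss ee; ring.
- move=> y; transitivity ((C u y * C u y) * (C v y * C v y)); first by ring.
  rewrite !conference_sqr ![_ == y]eq_sym.
  by have [->|yu] := eqVneq y u; rewrite ?(negbTE uv) /=; ring.
Qed.

End ConferenceCube.

(** * Constant entries on distinct triples *)

Definition distinct3 n (x y z : 'I_n) : bool := [&& x != y, y != z & z != x].

(** Each of the four mixed sums counts, with weight [s], the n - 2 indices that complete a pair to a
    distinct triple. *)
Lemma sum_const_cube_mul n (a0 a1 a2 a3 s : int) (u v : 'I_n) :
    is_sign a1 -> is_sign s -> u != v ->
  let H := fill_cube a0 a1 a2 a3 (fun x y z => s * (distinct3 x y z)%:R) in
  \sum_y \sum_z H u y z * H v y z =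
    2 * (a0 * a1 + a2 * a3) +
    (n%:R - 2) * (n%:R - 2 + 2 * s * (a2 + a3)).
Proof.
move=> s1 ss uv H; have sss := is_sign_sqr ss.
have vu : v != u by rewrite eq_sym.
pose w (i j y : 'I_n) : int := 1 - (y == i)%:R - (y == j)%:R.
have sw i j : \sum_y w i j y = n%:R - 2.
  rewrite !sumrB sumr_const card_ord.
  under [X in _ - X - _]eq_bigr => y _ do rewrite -[_%:R]mulr1.
  under [X in _ - _ - X]eq_bigr => y _ do rewrite -[_%:R]mulr1.
  by rewrite !sum_pred1; ring.
rewrite (@sum_fill_cube_mul _ a0 a1 a2 a3 _ _ _ _ _ u v (w u v)) //.
- have mid (i j : 'I_n) : i != j ->
      \sum_z s * (distinct3 i j z)%:R = s * (n%:R - 2).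
    move=> ij; rewrite -(sw i j) -mulr_sumr; congr (_ * _).
    apply: eq_bigr => z _; rewrite /distinct3 /w ij [j == z]eq_sym.
    have [->|zi] := eqVneq z i; first by rewrite andbF (negbTE ij).
    by case: (z == j).
  have last (i j : 'I_n) : i != j ->
      \sum_y s * (distinct3 i y j)%:R = s * (n%:R - 2).
    move=> ij; rewrite -(sw i j) -mulr_sumr; congr (_ * _).
    apply: eq_bigr => z _.
    rewrite /distinct3 /w [j == i]eq_sym ij andbT [i == z]eq_sym.
    have [->|zi] := eqVneq z i; first by rewrite (negbTE ij).
    by case: (z == j).
  by rewrite sw !mid // !last //; ring.
- by move=> x z; rewrite /distinct3 eqxx mulr0.
- by move=> x y; rewrite /distinct3 eqxx !andbF mulr0.
- by move=> x y; rewrite /distinct3 eqxx andbF mulr0.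
- move=> y z; transitivity (s * s *
    ((distinct3 u y z)%:R * (distinct3 v y z)%:R)); first by ring.
  rewrite sss /distinct3 /w ![u == _]eq_sym ![v == _]eq_sym.
  have [->|_] := eqVneq y u; rewrite ?(negbTE uv) /=; first by ring.
  have [->|_] := eqVneq y v; rewrite ?(negbTE uv) /=; first by ring.
  have [->|_] := eqVneq z u; rewrite ?(negbTE uv) ?andbF /=; first by ring.
  have [->|_] := eqVneq z v; rewrite ?(negbTE uv) ?andbF /=; first by ring.
  by case: (y == z); rewrite /=; ring.
- move=> y; rewrite /w.
  have [->|_] := eqVneq y u; rewrite ?(negbTE uv) /=; first by ring.
  by case: (y == v); rewrite /=; ring.
Qed.

(** Allows the branch on the sign of [triangle] to be traded for a formula that vanishes when
    indices coincide, as [sum_fill_cube_mul] requires. *)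
Lemma eq_fill_cube n (a0 a1 a2 a3 : int) (t t' : 'I_n -> 'I_n -> 'I_n -> int) :
  (forall x y z, x != y -> y != z -> z != x -> t x y z = t' x y z) ->
  forall x y z, fill_cube a0 a1 a2 a3 t x y z = fill_cube a0 a1 a2 a3 t' x y z.
Proof.
move=> tt' x y z; rewrite /fill_cube.
have [//|yz] := eqVneq y z; have [//|xz] := eqVneq x z.
by have [//|xy] := eqVneq x y; apply: tt'; rewrite // eq_sym.
Qed.

(** * Layers as double sums, and cyclic symmetry of the cube *)

(* Coordinates are indexed cyclically: [k + 1] is addition in 'I_3. *)
Definition place n (k : 'I_3) (x y z : 'I_n) : cell n 3 :=
  [ffun i => if i == k then x else if i == k + 1 then y else z].

Lemma I3_shift (k : 'I_3) :
  [/\ (k + 1 == k) = false, (k + 2 == k) = false, (k + 2 == k + 1) = false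
    & forall i, i != k -> i != k + 1 -> i = k + 2].
Proof.
case: k => [[|[|[|]]] //= ?]; split=> // -[[|[|[|]]] //= ?] *;
  exact: val_inj.
Qed.

Lemma sum_layer1 n (H : cell n 3 -> int) (k : 'I_3) (u v : cell n 3) :
  \sum_(p in layer [set k] u) H p * H (move_to_layer [set k] v p) =
  \sum_y \sum_z H (place k (u k) y z) * H (place k (v k) y z).
Proof.
have [k1 k2 k21 k3] := I3_shift k.
(* A cell of the layer is determined by its two free coordinates, k + 1 and k + 2. *)
rewrite pair_big /= (reindex_onto (fun q => place k (u k) q.1 q.2)
  (fun p => (p (k + 1), p (k + 2)))) => [|p].
  apply: eq_big => [[y z]|[y z] _] /=.
    rewrite !ffunE k1 k2 k21 !eqxx andbT inE.
    by apply/'forall_implyP => i /set1P ->; rewrite ffunE eqxx.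
  congr (_ * H _); apply/ffunP => i; rewrite !ffunE inE.
  by have [->|_] := eqVneq i k.
rewrite inE => /'forall_implyP /(_ k (set11 k)) /eqP pk.
apply/ffunP => i; rewrite ffunE; have [->//|ik] := eqVneq i k.
by have [->//|ik1] := eqVneq i (k + 1); rewrite [i]k3.
Qed.

(** [a (face k)] is the value where coordinate k differs from the other two, which agree. *)
Definition face (k : 'I_3) : 'I_6 := tnth [tuple 1; 2; 3] k.

(** [triangle] is invariant under rotation, so a cyclic shift of the coordinates merely rotates
    [a 1], [a 2], [a 3]. *)
Lemma conference_cube_place n (C : 'M[int]_n) (a : 'I_6 -> int) (k : 'I_3)
    x y z :
  conference_cube C a (place k x y z) =
    fill_cube (a 0) (a (face k)) (a (face (k + 1))) (a (face (k + 2)))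
      (fun x y z => if triangle C x y z == -1 then a 4 else a 5) x y z.
Proof.
rewrite /conference_cube /fill_cube !ffunE -/(triangle _ _ _ _).
rewrite /face; case: k => [[|[|[|]]]] //= ?; rewrite !(tnth_nth 0) /=
  ?[z == x]eq_sym ?[z == y]eq_sym ?[y == x]eq_sym
  -?[triangle C z x y]triangle_rot ?[triangle C y z x]triangle_rot;
  (have [<-|xy] := eqVneq x y; [by case: (x == z)|]);
  (have [<-|_] := eqVneq y z; first by rewrite (negbTE xy));
  by case: (x == z).
Qed.

Lemma layer1_neq n (k : 'I_3) (u v : cell n 3) :
  (layer [set k] u != layer [set k] v) = (u k != v k).
Proof.
congr (~~ _); apply/eqP/eqP => [uv|uv].
  have: u \in layer [set k] v.
    by rewrite -uv inE; apply/'forall_implyP.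
  by rewrite inE => /'forall_implyP /(_ k (set11 k)) /eqP.
by apply/setP => p; rewrite !inE; apply/'forall_implyP/'forall_implyP => h i
   /set1P ->; move: (h k (set11 k)); rewrite uv.
Qed.

Theorem theorem1p3 (n : nat) (C : 'M[int]_n) (a : 'I_6 -> int)
    (hC : conference_matrix C)
    (hsym : C^T = C \/ C^T = - C)
    (ha : forall i, is_sign (a i)) :
  (a 0 * a 1 * a 2 * a 3 = -1 /\ a 4 * a 5 = -1 ->
     hadamard_hypercube 2 (conference_cube C a)) /\
  ((6 < n)%N ->
     hadamard_hypercube 2 (conference_cube C a) ->
     a 0 * a 1 * a 2 * a 3 = -1 /\ a 4 * a 5 = -1).
Proof.
set t := (fun x y z : 'I_n => if triangle C x y z == -1 then a 4 else a 5).
have t_opp : a 4 * a 5 = -1 -> forall x y z : 'I_n,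
    x != y -> y != z -> z != x -> t x y z = a 5 * triangle C x y z.
  move=> a45 x y z xy yz zx; rewrite /t.
  have := triangle_sign hC xy yz zx.
  case=> ->; last rewrite eqxx; first by rewrite mulr1.
  by move: a45; case: (ha 4) => ->; case: (ha 5) => ->.
split=> [[a0123 a45]|n6 [_ _ hH]].
  split=> // [p|S /eqP/cards1P[k ->{S}] u v].
    rewrite /conference_cube; do ![case: ifP => // _].
  rewrite layer1_neq /orthogonal_layers sum_layer1 => uv.
  under eq_bigr => y _ do under eq_bigr => z _ do
    rewrite !conference_cube_place !(eq_fill_cube _ _ _ _ (t_opp a45)).
  rewrite sum_triangle_cube_mul //.
  (* The sign condition is the same in all three directions; it makes [a 0 * a (face k)] and the
     product of the other two constants opposite signs. *)
  have a123 :
      a (face k) * a (face (k + 1)) * a (face (k + 2)) = a 1 * a 2 * a 3.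
    rewrite /face !(tnth_nth 0).
    by case: k {uv} => [[|[|[|]]]] //= ?; ring.
  have : a 0 * a (face k) * a (face (k + 1)) * a (face (k + 2)) = -1.
    by rewrite -a0123 -!mulrA; congr (_ * _); rewrite !mulrA.
  by case: (ha 0) (ha (face k)) (ha (face (k + 1))) (ha (face (k + 2))) =>
    -> [] -> [] -> [] ->.
have n_gt0 : (0 < n)%N by apply: leq_trans n6.
have n_gt1 : (1 < n)%N by apply: leq_trans n6.
(* For the converse a single pair of layers suffices: first coordinate 0 and first coordinate 1. *)
pose u : cell n 3 := [ffun=> Ordinal n_gt0].
pose v : cell n 3 := [ffun=> Ordinal n_gt1].
have uv : u 0 != v 0 by rewrite !ffunE.
have := hH [set 0] (cards1 _) u v.
rewrite layer1_neq /orthogonal_layers sum_layer1 => /(_ uv).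
have [a45|a45] : a 4 * a 5 = -1 \/ a 4 = a 5.
  by case: (ha 4) => ->; case: (ha 5) => ->; auto.
  under eq_bigr => y _ do under eq_bigr => z _ do
    rewrite !conference_cube_place !(eq_fill_cube _ _ _ _ (t_opp a45)).
  rewrite sum_triangle_cube_mul // => h; split=> //.
  by move: h; case: (ha 0) (ha 1) (ha 2) (ha 3) => -> [] -> [] -> [] ->.
have t_const x y z : x != y -> y != z -> z != x ->
    t x y z = a 5 * (distinct3 x y z)%:R.
  by move=> xy yz zx; rewrite /t a45 if_same /distinct3 xy yz zx mulr1.
under eq_bigr => y _ do under eq_bigr => z _ do
  rewrite !conference_cube_place !(eq_fill_cube _ _ _ _ t_const).
rewrite sum_const_cube_mul // => h; exfalso; move: h.
(* With n = m + 7 and s = [a 5]: if a_2 = a_3 = -s, the product is (m+5)(m+1) + 2(a_0 a_1 + 1) > 0;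
   otherwise it is at least (m+5)^2 - 4 > 0. At n = 6 the first case could give 0. *)
rewrite -(subnK n6) natrD; set m := (n - 7)%N.
have : 0 <= m%:R :> int by apply: ler0n.
move: (m%:R : int) => x x0.
case: (ha 0) (ha 1) (ha 2) (ha 3) (ha 5) => -> [] -> [] -> [] -> [] ->; nia.
Qed.
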